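(* Let $\mathbb{Y}$ be a subspace of $\ell_1^n$ and let $\mathcal{A}=\{\widetilde{a_1},\ldots,\widetilde{a_m}\}$ be a basis of $\mathbb{Y}$ with $|\mathcal{Z}_{\mathcal{A}}|=r>0$. Let $k=n-r$. Then $\mathbb{Y}$ is a coproximinal subspace of $\ell_1^n$ if and only if $\sigma(\mathbb{Y})=\mathrm{span}\{\sigma(\widetilde{a_1}),\ldots,\sigma(\widetilde{a_m})\}$ is a coproximinal subspace of $\ell_1^k$.
   Context: $\ell_1^n$ is $\mathbb{R}^n$ with the norm $\sum_i|x_i|$. For a linearly independent set $\mathcal{A}=\{\widetilde{a_1},\ldots,\widetilde{a_m}\}$ in $\ell_1^n$ with $\widetilde{a_k}=(a^k_1,\ldots,a^k_n)$, the zero set is $\mathcal{Z}_{\mathcal{A}}=\{i\in\{1,\ldots,n\}:(a_i^1,\ldots,a_i^m)=(0,\ldots,0)\}$. With $k=n-|\mathcal{Z}_{\mathcal{A}}|$, the linear map $\sigma:\ell_1^n\to\ell_1^k$ deletes the coordinates indexed by $\mathcal{Z}_{\mathcal{A}}$: $\sigma(b_1,\ldots,b_n)=(b_{i_1},\ldots,b_{i_k})$, where $i_1<\cdots<i_k$ are the elements of $\{1,\ldots,n\}\setminus\mathcal{Z}_{\mathcal{A}}$. An element $y_0\in\mathbb{Y}$ is a best coapproximation to $x$ out of $\mathbb{Y}$ if $\|y_0-y\|\le\|x-y\|$ for all $y\in\mathbb{Y}$. A subspace $\mathbb{Y}$ of a Banach space $\mathbb{X}$ is coproximinal if every $x\in\mathbb{X}$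 has a best coapproximation out of $\mathbb{Y}$. *)

(* Defs.v *)
From HB Require Import structures.
From mathcomp Require Import all_boot all_order all_algebra.
From mathcomp Require Import reals.

Set Implicit Arguments.
Unset Strict Implicit.
Unset Printing Implicit Defensive.

Import Order.TTheory GRing.Theory Num.Theory.
Local Open Scope ring_scope.

(* The norm is an explicit function: the norm that MathComp-Analysis attaches
   to row vectors is the sup norm. *)
Definition l1norm (R : realType) (n : nat) (x : 'rV[R]_n) : R :=
  \sum_(i < n) `|x 0 i|.

Definition best_coapproximation (R : realType) (V : vectType R) (N : V -> R)
    (Y : {vspace V}) (x y0 : V) : Prop :=
  y0 \in Y /\ forall y : V, y \in Y -> N (y0 - y) <= N (x - y).

Definition coproximinal (R : realType) (V : vectType R) (N : V -> R)
    (Y : {vspace V}) : Prop :=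
  forall x : V, exists y0 : V, best_coapproximation N Y x y0.

Definition zero_set (R : realType) (n m : nat) (A : m.-tuple 'rV[R]_n) :
    {set 'I_n} :=
  [set i | [forall k : 'I_m, tnth A k 0 i == 0]].

Lemma card_nonzero (R : realType) (n m : nat) (A : m.-tuple 'rV[R]_n) :
  (n - #|zero_set A|)%N = #|~: zero_set A|.
Proof. by rewrite [RHS]cardsCs setCK card_ord. Qed.

(* [enum_val] lists the complement of the zero set in increasing order, see
   [kept_index_mono]. *)
Definition kept_index (R : realType) (n m : nat) (A : m.-tuple 'rV[R]_n)
    (j : 'I_(n - #|zero_set A|)) : 'I_n :=
  enum_val (cast_ord (card_nonzero A) j).

Lemma kept_index_mono (R : realType) (n m : nat) (A : m.-tuple 'rV[R]_n)
    (i j : 'I_(n - #|zero_set A|)) :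
  (i < j)%N -> (kept_index i < kept_index j)%N.
Proof.
rewrite /kept_index => lt_ij; set S := ~: zero_set A.
set i' := cast_ord _ i; set j' := cast_ord _ j.
have x0 : 'I_n := enum_val i'.
rewrite !(enum_val_nth x0) -!(nth_map x0 0%N val) -?cardE //.
have srt : sorted ltn (map val (enum S)).
  rewrite {1}/enum_mem -enumT; apply: (subseq_sorted ltn_trans (s2 := iota 0 n)).
    by rewrite -val_enum_ord; apply/map_subseq/filter_subseq.
  exact: iota_ltn_sorted.
by apply: (sorted_ltn_nth ltn_trans) => //; rewrite inE size_map -cardE ltn_ord.
Qed.

Definition sigma (R : realType) (n m : nat) (A : m.-tuple 'rV[R]_n) :
    'Hom('rV[R]_n, 'rV[R]_(n - #|zero_set A|)) :=
  linfun (colsub (@kept_index R n m A)).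

(* [linfun] is only meaningful on linear functions, so this records that
   [sigma] does act by deleting coordinates. *)
Lemma sigmaE (R : realType) (n m : nat) (A : m.-tuple 'rV[R]_n)
    (b : 'rV[R]_n) (j : 'I_(n - #|zero_set A|)) :
  sigma A b 0 j = b 0 (kept_index j).
Proof. by rewrite lfunE mxE. Qed.

(* Main.v *)
(* Every element of Y vanishes on the zero set of a basis of Y, so sigma is
   isometric on Y, and also between any x vanishing there and Y. Deleting
   coordinates never increases the norm; hence best coapproximations transfer
   along sigma in one direction, and along extension by zero in the other. *)
Require Import Defs.
From HB Require Import structures.
From mathcomp Require Import all_boot all_order all_algebra.
From mathcomp Require Import reals.

Set Implicit Arguments.
Unset Strict Implicit.
Unset Printing Implicit Defensive.

Import Order.TTheory GRing.Theory Num.Theory.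
Local Open Scope ring_scope.

Lemma basis_zero_set (R : realType) (n m : nat) (Y : {vspace 'rV[R]_n})
    (A : m.-tuple 'rV[R]_n) (y : 'rV[R]_n) (i : 'I_n) :
  basis_of Y A -> y \in Y -> i \in zero_set A -> y 0 i = 0.
Proof.
move=> basisA yY; rewrite inE => /forallP Ai0.
rewrite (coord_basis basisA yY) summxE big1 // => k _.
by rewrite mxE -tnth_nth (eqP (Ai0 k)) mulr0.
Qed.

(** The sum splits at the zero set, and its other part is reindexed along [kept_index]. Both the
    contraction bound and the isometry below are read off from this identity. *)
Lemma l1norm_sigma (R : realType) (n m : nat) (A : m.-tuple 'rV[R]_n)
    (x : 'rV[R]_n) :
  l1norm x = l1norm (sigma A x) + \sum_(i in zero_set A) `|x 0 i|.
Proof.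
rewrite /l1norm (bigID (mem (zero_set A))) addrC /=; congr (_ + _).
under [RHS]eq_bigr do rewrite sigmaE /kept_index.
(* Undoing the cast inside [kept_index] leaves a bare [enum_val], whose sum is one over the
   complement. *)
rewrite (reindex (cast_ord (esym (card_nonzero A)))) /=; last first.
  by apply/onW_bij; exists (cast_ord (card_nonzero A)) => j; apply/val_inj.
under [RHS]eq_bigr do rewrite cast_ordKV.
rewrite -(big_enum_val (fun i => `|x 0 i|)).
by apply: eq_bigl => i; rewrite in_setC.
Qed.

Lemma l1norm_sigma_le (R : realType) (n m : nat) (A : m.-tuple 'rV[R]_n)
    (x : 'rV[R]_n) :
  l1norm (sigma A x) <= l1norm x.
Proof. by rewrite (l1norm_sigma A x) lerDl sumr_ge0. Qed.

Lemma l1norm_sigma_id (R : realType) (n m : nat) (A : m.-tuple 'rV[R]_n)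
    (x : 'rV[R]_n) :
  (forall i, i \in zero_set A -> x 0 i = 0) -> l1norm (sigma A x) = l1norm x.
Proof.
move=> x0; rewrite (l1norm_sigma A x) [X in _ + X]big1 ?addr0 // => i /x0 ->.
exact: normr0.
Qed.

Lemma sigma_lift (R : realType) (n m : nat) (A : m.-tuple 'rV[R]_n)
    (u : 'rV[R]_(n - #|zero_set A|)) :
  exists2 x : 'rV[R]_n,
    sigma A x = u & forall i, i \in zero_set A -> x 0 i = 0.
Proof.
(* Extension by zero: as [kept_index] is injective, the inner sum has one term at a kept coordinate
   and is empty on the zero set. *)
exists (\row_i \sum_(j | kept_index j == i) u 0 j).
  apply/rowP => j; rewrite sigmaE mxE (big_pred1 j) // => j'.
  by rewrite /= (inj_eq enum_val_inj) (inj_eq (@cast_ord_inj _ _ _)).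
move=> i Zi; rewrite mxE big1 // => j /eqP ji.
have := enum_valP (cast_ord (card_nonzero A) j).
by rewrite -/(kept_index j) ji in_setC Zi.
Qed.

Theorem theorem2p21 (R : realType) (n m : nat) (Y : {vspace 'rV[R]_n})
    (A : m.-tuple 'rV[R]_n) (basisA : basis_of Y A)
    (Z_gt0 : (0 < #|zero_set A|)%N) :
  (sigma A @: Y)%VS = <<map (sigma A) A>>%VS /\
  (coproximinal (@l1norm R n) Y <->
   coproximinal (@l1norm R (n - #|zero_set A|)) (sigma A @: Y)%VS).
Proof.
have eq_norm (x y : 'rV_n) : (forall i, i \in zero_set A -> x 0 i = 0) ->
    y \in Y -> l1norm (sigma A x - sigma A y) = l1norm (x - y).
  move=> x0 yY; rewrite -linearB; apply: l1norm_sigma_id => i Zi.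
  by rewrite !mxE x0 // (basis_zero_set basisA yY Zi) subr0.
split; first by rewrite -(span_basis basisA) limg_span.
split=> [copY u | copS x].
  (* An arbitrary preimage of [u] would not do: the upper bound too must keep its norm under
     [sigma]. *)
  have [x <- x0] := sigma_lift u.
  have [y0 [y0Y y0P]] := copY x; exists (sigma A y0).
  split=> [|_ /memv_imgP[y yY ->]]; first exact: memv_img.
  rewrite !eq_norm //; first exact: y0P.
  by move=> i; apply: (basis_zero_set basisA).
have [_ [/memv_imgP[y0 y0Y ->] y0P]] := copS (sigma A x); exists y0.
(* Only the left side needs equality, and [y0] lies in [Y]; for the arbitrary [x] on the right,
   contraction suffices. *)
split=> // y yY; rewrite -eq_norm //; last first.
  by move=> i; apply: (basis_zero_set basisA).
apply: le_trans (y0P _ (memv_img _ yY)) _.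
by rewrite -linearB l1norm_sigma_le.
Qed.
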